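(* Let $T$ be a contraction on a Hilbert space $\mathcal{H}$, let $f\in C(\mathbb{T})$, and let $U_T$ and $V_T$ be two unitary dilations of $T$ on Hilbert spaces $\mathcal{K}_1\supset\mathcal{H}$ and $\mathcal{K}_2\supset\mathcal{H}$ respectively. Then $$P_{\mathcal{H}}f(U_T)|_{\mathcal{H}}=P_{\mathcal{H}}f(V_T)|_{\mathcal{H}},$$ where $P_{\mathcal{H}}$ denotes the orthogonal projection onto $\mathcal{H}$ from $\mathcal{K}_1$ on the left-hand side and from $\mathcal{K}_2$ on the right-hand side. That is, the operator $f(T):=P_{\mathcal{H}}f(U_T)|_{\mathcal{H}}$ is independent of the choice of the unitary dilation $U_T$.
   Context: $\mathbb{T}$ is the unit circle. A contraction is an operator $T\in\mathcal{B}(\mathcal{H})$ with $\|T\|\le1$. A unitary dilation of $T$ is a unitary operator $U_T$ on a Hilbert space $\mathcal{K}$ containing $\mathcal{H}$ as a closed subspace such that $T^n=P_{\mathcal{H}}U_T^n|_{\mathcal{H}}$ for all $n\in\mathbb{Z}$, where $T^{-|n|}=(T^* )^{|n|}$ and $P_{\mathcal{H}}$ is the orthogonal projection of $\mathcal{K}$ onto $\mathcal{H}$. For a unitary $U$ and $f\in C(\mathbb{T})$, $f(U)$ is given by the continuous functional calculus. *)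

(* Defs.v *)
From HB Require Import structures.
From mathcomp Require Import all_boot all_order all_algebra.
From mathcomp Require Import sesquilinear complex.
From mathcomp Require Import all_classical all_reals all_analysis.

Set Implicit Arguments.
Unset Strict Implicit.
Unset Printing Implicit Defensive.

Import Order.TTheory GRing.Theory Num.Theory.
Import numFieldNormedType.Exports.

Local Open Scope classical_set_scope.
Local Open Scope ring_scope.
Local Open Scope complex_scope.

(* Complex Hilbert spaces. The inner product is linear in its first argument
   and conjugate-linear in the second one; norms over R[i] take values in R[i]. *)
HB.mixin Record CompleteNormedModule_isHilbert (R : realType) H
    & CompleteNormedModule R[i] H := {
  inner : {dot H for (@Num.conj R[i])};
  normr_inner : forall x : H, `|x| ^+ 2 = inner x x
}.

#[short(type="hilbertType")]
HB.structure Definition Hilbert (R : realType) :=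
  {H of CompleteNormedModule R[i] H & CompleteNormedModule_isHilbert R H}.

Record bounded_operator (R : realType) (H K : hilbertType R) := BoundedOperator {
  bop_linear :> {linear H -> K};
  bop_continuous : continuous bop_linear
}.

HB.instance Definition _ (R : realType) (H K : hilbertType R) :=
  gen_eqMixin (bounded_operator H K).
HB.instance Definition _ (R : realType) (H K : hilbertType R) :=
  gen_choiceMixin (bounded_operator H K).

Notation "''B' ( H )" := (bounded_operator H H) (format "''B' ( H )") : type_scope.

Section Operators.
Context {R : realType}.
Implicit Types H K : hilbertType R.

Definition opnorm H K (T : bounded_operator H K) : R :=
  sup [set complex.Re `|T x| | x in [set x : H | `|x| <= 1]].

Definition contraction_operator H (T : 'B(H)) : Prop := opnorm T <= 1.

(* adjoint T y is the vector representing the functional x |-> inner (T x) y.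
   The default of xget is never reached here (Riesz representation), in
   orthoproj (closed range of J) or in cfc (existence of the calculus), and
   the value selected is unique (for cfc U f, when f is continuous). *)
Definition adjoint H K (T : bounded_operator H K) (y : K) : H :=
  xget 0 [set z | forall x, inner (T x) y = inner x z].

Definition unitary_operator H (U : 'B(H)) : Prop :=
  cancel U (adjoint U) /\ cancel (adjoint U) U.

(* T ^ n for n : int, with T ^ (- n) = (T^* ) ^ n. *)
Definition opexpz H (T : 'B(H)) (n : int) : H -> H :=
  match n with
  | Posz k => iter k T
  | Negz k => iter k.+1 (adjoint T)
  end.

(* An inclusion of H as a closed subspace of K is given by an isometry
   J : H -> K; its range is closed because H is complete. *)
Definition isometric_embedding H K (J : {linear H -> K}) : Prop :=
  forall x y, inner (J x) (J y) = inner x y.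

(* The orthogonal projection of K onto J(H), with values read back in H. *)
Definition orthoproj H K (J : {linear H -> K}) (k : K) : H :=
  xget 0 [set h | forall h', inner (k - J h) (J h') = 0].

Definition compression H K (J : {linear H -> K}) (A : 'B(K)) : H -> H :=
  fun h => orthoproj J (A (J h)).

Definition unitary_dilation H K (J : {linear H -> K}) (T : 'B(H)) (U : 'B(K)) :=
  [/\ isometric_embedding J, unitary_operator U
    & forall (n : int) (h : H), opexpz T n h = orthoproj J (opexpz U n (J h))].

Definition zero_operator H K : bounded_operator H K :=
  @BoundedOperator R H K \0 (fun=> cvg_cst _).

End Operators.

Section FunctionalCalculus.
Context {R : realType}.

(* R[i]^o is R[i] seen as a normed module over itself, which carries the
   topology of the norm; circle, used as a type, has the induced topology. *)
Definition circle : set R[i]^o := [set z | `|z| = 1].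

(* Phi restricts to a unital *-homomorphism from C(circle) to B(K) that maps
   the coordinate function z to U. Phi takes arbitrary functions as arguments,
   but only its values at continuous ones are constrained. *)
Definition is_functional_calculus (K : hilbertType R) (U : 'B(K))
    (Phi : (circle -> R[i]^o) -> 'B(K)) : Prop :=
  [/\ forall x, Phi (fun=> 1) x = x,
      forall x, Phi (fun z => \val z) x = U x,
      forall (a : R[i]) (f g : circle -> R[i]^o), continuous f -> continuous g ->
        forall x, Phi (fun z => a * f z + g z) x = a *: Phi f x + Phi g x,
      forall f g : circle -> R[i]^o, continuous f -> continuous g ->
        forall x, Phi (fun z => f z * g z) x = Phi f (Phi g x)
    & forall f : circle -> R[i]^o, continuous f ->
        forall x, Phi (fun z => (f z)^*) x = adjoint (Phi f) x].

(* f(U) for f in C(circle) and U unitary. The spectrum of U lies in the circle,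
   and the composite of the restriction C(circle) -> C(spectrum of U) with the
   continuous functional calculus of U is the only unital *-homomorphism
   C(circle) -> B(K) mapping z to U. *)
Definition cfc (K : hilbertType R) (U : 'B(K)) : (circle -> R[i]^o) -> 'B(K) :=
  xget (fun=> zero_operator K K) [set Phi | is_functional_calculus U Phi].

End FunctionalCalculus.
Arguments circle R : clear implicits.

(* Main.v *)
Require Import Defs.
From HB Require Import structures.
From mathcomp Require Import all_boot all_order all_algebra.
From mathcomp Require Import sesquilinear complex cyclic cyclotomic separable.
From mathcomp Require Import all_classical all_reals all_analysis.
From mathcomp Require Import ring lra.
Import Order.TTheory GRing.Theory Num.Theory.
Import numFieldNormedType.Exports.

Local Open Scope classical_set_scope.
Local Open Scope ring_scope.
Local Open Scope complex_scope.

(** A dilation determines the matrix elements of the integer powers: for a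
    unitary dilation U of T along an isometry J, the vector T ^ n h represents
    the functional h' |-> inner (U ^ n (J h)) (J h') (lemma dilation_opexpz).
    So two dilations give the same compressions of trigonometric polynomials in
    the unitary, and the theorem follows by uniform approximation, as soon as
    three facts are known.

    - Density (continuous_circle_ind).  The Fejer-type operator
        f |-> sum_j f (w_j) F_j,
        F_j (z) = N ^ -2 |sum_(k < N) (z / w_j) ^ k| ^ 2,
      where the w_j are the N-th roots of unity, has trigonometric polynomials
      as values.  The F_j are nonnegative, have sum 1 and quadratic moment
      sum_j F_j (z) |w_j - z| ^ 2 <= 4 / N; convexity and uniform continuity then
      give the uniform convergence to f.

    - Boundedness of any functional calculus (calculus_bound).  If u has modulus
      1 everywhere, the calculus maps u to an isometry.  A continuous function
      with values in [-1, 1] is the average of u and its conjugate for such a u.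

    - Existence of a functional calculus (functional_calculus_exists), without
      which cfc would take its default value.  For a unitary U, the discrete
      Fourier transforms of the orbit
        S_j x = sum_(k < N) (w_j)^-k U ^ k x
      give an isometry x |-> (S_j x / N)_j of K into K ^ N, and S_j (U x) differs
      from w_j S_j x by a boundary term of norm at most 2 |x|.  Thus U is
      approximately the multiplication by the sequence (w_j), and y = f(U) x is
      defined by the condition that the mean square of the S_j y - f (w_j) S_j x
      tends to 0 with 1 / N (relation acts).  This relation is linear in f and in
      (x, y), multiplicative in f, bounded by the supremum of |f| and compatible
      with adjoints; it contains the coordinate function, hence by density it
      is defined for every continuous f.

    The orthogonal projection onto the range of J exists by the classical
    minimisation argument (projection_exists).

    Norms of the library over R[i] take complex values; all the estimates below
    are about squared norms and squared moduli, which are kept in R.  Squares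
    also replace the triangle inequality by |x + y| ^ 2 <= 2 (|x| ^ 2 + |y| ^ 2),
    which only affects constants. *)

Set Implicit Arguments.
Unset Strict Implicit.
Unset Printing Implicit Defensive.

(** * Squared moduli and squared norms *)

Section SquaredModulus.
Context {R : realType}.
Implicit Types a b z : R[i].

Definition sqmod z : R := complex.Re z ^+ 2 + complex.Im z ^+ 2.

Lemma sqmod_ge0 z : 0 <= sqmod z.
Proof. by rewrite addr_ge0 ?sqr_ge0. Qed.

Lemma sqmod_normr z : (sqmod z)%:C = `|z| ^+ 2.
Proof. exact: add_Re2_Im2. Qed.

Lemma sqmodJ z : sqmod z^*%C = sqmod z.
Proof. by case: z => x y; rewrite /sqmod /= sqrrN. Qed.

Lemma sqmodE z : (sqmod z)%:C = z * z^*%C.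
Proof. by rewrite sqmod_normr sqr_normc. Qed.

Lemma sqmodM a b : sqmod (a * b) = sqmod a * sqmod b.
Proof. by case: a b => [a1 a2] [b1 b2]; rewrite /sqmod /=; ring. Qed.

Lemma sqmodN z : sqmod (- z) = sqmod z.
Proof. by case: z => x y; rewrite /sqmod /= !sqrrN. Qed.

Lemma sqmodX z n : sqmod (z ^+ n) = sqmod z ^+ n.
Proof.
elim: n => [|n IHn]; last by rewrite !exprS sqmodM IHn.
by rewrite !expr0 /sqmod /= expr1n expr0n addr0.
Qed.

Lemma sqmod_real (x : R) : sqmod x%:C = x ^+ 2.
Proof. by rewrite /sqmod /= expr0n addr0. Qed.

Lemma sqmod_eq0 z : sqmod z = 0 -> z = 0.
Proof.
move=> h; apply/eqP; rewrite -normr_eq0 -sqrf_eq0 -sqmod_normr h.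
by [].

Qed.

Lemma sqmodD_le a b : sqmod (a + b) <= 2 * (sqmod a + sqmod b).
Proof.
case: a b => [a1 a2] [b1 b2]; rewrite /sqmod /=.
have := sqr_ge0 (a1 - b1); have := sqr_ge0 (a2 - b2); nra.
Qed.

Lemma circle_sqmod (z : circle R) : sqmod (\val z) = 1.
Proof.
case: z => z /= /set_mem; rewrite /circle /= => z1.
by apply: (@complexI R); rewrite sqmod_normr z1 expr1n.
Qed.

Lemma sqmod_circle z : sqmod z = 1 -> circle R z.
Proof.
move=> z1; rewrite /circle /=; apply/eqP.
by rewrite -(@eqrXn2 _ 2) // expr1n -sqmod_normr z1.
Qed.

Lemma circle_mulJ (z : circle R) : \val z * (\val z)^*%C = 1.
Proof. by rewrite -sqmodE circle_sqmod. Qed.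

End SquaredModulus.

Section SquaredNorm.
Context {R : realType} {H : hilbertType R}.
Implicit Types x y z : H.

Definition sqn x : R := complex.Re (inner x x).

Lemma sqn_normr x : (sqn x)%:C = `|x| ^+ 2.
Proof.
by rewrite /sqn -normr_inner RRe_real // realX // normr_real.
Qed.

Lemma sqnE x : (sqn x)%:C = inner x x.
Proof. by rewrite sqn_normr normr_inner. Qed.

Lemma sqn_ge0 x : 0 <= sqn x.
Proof. by rewrite -ler0c sqn_normr exprn_ge0. Qed.

Lemma sqn_eq0 x : sqn x = 0 -> x = 0.
Proof.
by move=> h; apply/eqP; rewrite -normr_eq0 -sqrf_eq0 -sqn_normr h.
Qed.

Lemma sqn0 : sqn (0 : H) = 0.
Proof. by rewrite /sqn linear0l. Qed.

Lemma innerC x y : inner y x = (inner x y)^*%C.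
Proof. by rewrite hermC /= expr0 mul1r. Qed.

Lemma innerDl x y z : inner (x + y) z = inner x z + inner y z.
Proof. exact: linearDl. Qed.

Lemma innerDr x y z : inner x (y + z) = inner x y + inner x z.
Proof. exact: linearDr. Qed.

Lemma innerNl x z : inner (- x) z = - inner x z.
Proof. exact: linearNl. Qed.

Lemma innerNr x z : inner x (- z) = - inner x z.
Proof. exact: linearNr. Qed.

Lemma innerZl (a : R[i]) x y : inner (a *: x) y = a * inner x y.
Proof. by rewrite linearZl_LR. Qed.

Lemma innerZr (a : R[i]) x y : inner x (a *: y) = a^*%C * inner x y.
Proof. by rewrite linearZr_LR. Qed.

Lemma sqnZ (a : R[i]) x : sqn (a *: x) = sqmod a * sqn x.
Proof.
apply: (@complexI R); rewrite rmorphM /= !sqnE sqmodE innerZr innerZl.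
by rewrite mulrA (mulrC a).
Qed.

Lemma sqnN x : sqn (- x) = sqn x.
Proof. by rewrite -scaleN1r sqnZ sqmodN (sqmod_real 1) expr1n mul1r. Qed.

Lemma sqnBC x y : sqn (x - y) = sqn (y - x).
Proof. by rewrite -sqnN opprB. Qed.

Lemma parallelogram x y : sqn (x + y) + sqn (x - y) = 2 * (sqn x + sqn y).
Proof.
rewrite /sqn !(innerDl, innerDr, innerNl, innerNr).
by rewrite !raddfD /= !raddfN /=; ring.
Qed.

Lemma sqnD_le x y : sqn (x + y) <= 2 * (sqn x + sqn y).
Proof. by rewrite -parallelogram lerDl sqn_ge0. Qed.

Lemma sqnB_le x y : sqn (x - y) <= 2 * (sqn x + sqn y).
Proof. by rewrite -parallelogram lerDr sqn_ge0. Qed.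

(** The component of x orthogonal to y, scaled by the squared norm of y so that
    no division occurs. *)
Lemma sqn_residual x y :
  sqn ((sqn y)%:C *: x - inner x y *: y) =
  sqn y * (sqn x * sqn y - sqmod (inner x y)).
Proof.
set c := inner x y; apply: (@complexI R); rewrite [LHS]sqnE.
rewrite !(innerDl, innerDr, innerNl, innerNr, innerZl, innerZr).
rewrite (innerC x y) -/c -!sqnE conjc_real.
rewrite !(rmorphM, rmorphB) /= sqmodE.
by ring.
Qed.

Lemma cauchy_schwarz x y : sqmod (inner x y) <= sqn x * sqn y.
Proof.
have [y0|y0] := eqVneq (sqn y) 0.
  by rewrite y0 mulr0 (sqn_eq0 y0) linear0r /sqmod /= expr0n addr0.
have ypos : 0 < sqn y by rewrite lt_neqAle eq_sym y0 sqn_ge0.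
have := sqn_ge0 ((sqn y)%:C *: x - inner x y *: y).
by rewrite sqn_residual pmulr_rge0 // subr_ge0.
Qed.

(** A linearised Cauchy-Schwarz inequality: unlike the usual form it can be
    summed term by term over a finite family. *)
Lemma young x y (t : R) : 0 < t ->
  complex.Re (inner x y) <= t * sqn x + t^-1 * sqn y.
Proof.
move=> t0.
have := sqn_ge0 (t%:C *: x - y); rewrite /sqn.
rewrite !(innerDl, innerDr, innerNl, innerNr, innerZl, innerZr).
rewrite (innerC x y) -!sqnE conjc_real.
case: (inner x y) => a b /= h.
have tV : 0 < t^-1 by rewrite invr_gt0.
have ttV : t * t^-1 = 1 by rewrite divff // gt_eqF.
have := sqn_ge0 x; have := sqn_ge0 y; nra.
Qed.

(** Completeness, for the Cauchy criterion produced by approximations of known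
    quality c n and by minimising sequences. *)
Lemma sqn_cauchy (u : nat -> H) (c : nat -> R) :
    c n @[n --> \oo] --> (0 : R) ->
    (forall m n, sqn (u m - u n) <= c m + c n) ->
  exists y, sqn (u n - y) @[n --> \oo] --> (0 : R).
Proof.
move=> c0 uc.
have norm_lt (x : H) (e : R) : 0 < e -> sqn x < e ^+ 2 -> `|x| < e%:C.
  move=> e0 xe.
  rewrite -(@ltr_pXn2r _ 2) // ?nnegrE ?ler0c ?normr_ge0 ?(ltW e0) //.
  by rewrite -sqn_normr -rmorphXn ltcR.
have epsR (z : R[i]) : 0 < z -> exists2 r : R, 0 < r & z = r%:C.
  case: z => a b; rewrite ltcE /= => /andP[/eqP-> a0]; by exists a.
have cu : cvg (u @ \oo).
  apply/cauchy_cvgP/cauchy_ballP => eps eps0.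
  have [r r0 ->] := epsR _ eps0.
  have /cvgrPdist_lt/(_ (r ^+ 2 / 2)) := c0.
  rewrite divr_gt0 ?exprn_gt0 // => /(_ isT)[N _ cN].
  exists (u @` [set n | (N <= n)%N], u @` [set n | (N <= n)%N]) => /=.
    by split; exists N => // n /= Nn; exists n.
  move=> [_ _] /= [[m Nm <-] [n Nn <-]].
  rewrite -ball_normE /=; apply: norm_lt => //.
  have := cN _ Nm; have := cN _ Nn; rewrite /= !sub0r !normrN.
  have := uc m n; have := ler_norm (c m); have := ler_norm (c n); lra.
exists (lim (u @ \oo)); apply/cvgrPdist_lt => /= e e0.
have s0 : 0 < Num.sqrt e by rewrite sqrtr_gt0.
have /cvgrPdist_lt/(_ (Num.sqrt e)%:C) := cu; rewrite ltcR => /(_ s0).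
apply: filterS => n un; rewrite sub0r normrN ger0_norm ?sqn_ge0 // sqnBC.
rewrite -ltcR sqn_normr -[in ltRHS](sqr_sqrtr (ltW e0)) rmorphXn /=.
by rewrite ltr_pXn2r // ?nnegrE ?ler0c ?normr_ge0 ?(ltW s0).
Qed.

End SquaredNorm.

(** * Roots of unity and the discrete Fourier transform *)

Section RootsOfUnity.
Context {R : realType}.
Implicit Types (n : nat) (z : circle R).

Lemma prim_root_exists n : exists z : R[i], n.+1.-primitive_root z.
Proof.
have [rs rsE] := closed_field_poly_normal ('X^(n.+1) - 1 : {poly R[i]}).
rewrite (monicP _) ?monicXnsubC // scale1r in rsE.
have rs1 : all n.+1.-unity_root rs.
  by apply/allP => z; rewrite -root_prod_XsubC -rsE.
have szrs : (n.+1 < (size rs).+1)%N.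
  by rewrite -(size_prod_XsubC rs id) -rsE size_XnsubC.
have urs : uniq rs.
  by rewrite -separable_prod_XsubC -rsE separable_Xn_sub_1 // pnatr_eq0.
by have /hasP[z _ zP] := has_prim_root (ltn0Sn n) rs1 urs szrs; exists z.
Qed.

Definition prim_root n : R[i] := xget 0 [set z | n.+1.-primitive_root z].

Lemma prim_rootP n : n.+1.-primitive_root (prim_root n).
Proof. exact: (xgetPex 0 (prim_root_exists n)). Qed.

Lemma prim_root_sqmod n j : sqmod (prim_root n ^+ j) = 1.
Proof.
rewrite sqmodX; suff -> : sqmod (prim_root n) = 1 by rewrite expr1n.
apply/eqP; rewrite -(@eqrXn2 _ n.+1) ?sqmod_ge0 // -sqmodX.
by rewrite (prim_expr_order (prim_rootP n)) expr1n (sqmod_real 1) expr1n.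
Qed.

(** The (n + 1)-th roots of unity: the number of nodes is positive by
    construction. *)
Definition node n (j : 'I_n.+1) : circle R :=
  SigSub (mem_set (sqmod_circle (prim_root_sqmod n j))).

Lemma node_expr n (j : 'I_n.+1) : \val (node j) ^+ n.+1 = 1.
Proof.
by rewrite /= -exprM mulnC exprM (prim_expr_order (prim_rootP n)) expr1n.
Qed.

Lemma character_sum n (k l : 'I_n.+1) :
  \sum_(j < n.+1) (\val (node j))^*%C ^+ k * \val (node j) ^+ l =
  (k == l)%:R * n.+1%:R.
Proof.
set w := prim_root n; pose r := w^*%C ^+ k * w ^+ l.
have wJ m : w^*%C ^+ m * w ^+ m = 1.
  by rewrite -rmorphXn mulrC -sqmodE prim_root_sqmod.
under eq_bigr => j _.
  have -> : (\val (node j))^*%C ^+ k * \val (node j) ^+ l = r ^+ j.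
    rewrite /= -/w rmorphXn /= -!exprM exprMn -!exprM.
    by rewrite ![(j * _)%N]mulnC.
  over.
have [kl|kl] := eqVneq k l.
  rewrite mul1r; under eq_bigr do rewrite /r -kl wJ expr1n.
  by rewrite sumr_const card_ord.
rewrite mul0r; have r1 : r - 1 != 0.
  rewrite subr_eq0; apply: contra kl => /eqP r1.
  have : w ^+ l = w ^+ k.
    by rewrite -[RHS]mul1r -r1 /r mulrAC wJ mul1r.
  by move/eqP; rewrite (eq_prim_root_expr (prim_rootP n)) !modn_small // eq_sym.
apply: (mulfI r1); rewrite -subrX1 mulr0 /r exprMn -!exprM ![(_ * n.+1)%N]mulnC.
rewrite !exprM -rmorphXn /= (prim_expr_order (prim_rootP n)) rmorph1 !expr1n.
by rewrite mulr1 subrr.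
Qed.

(** Orthogonality of characters applied to a double sum. It gives both the
    isometry property of the orbit transform of a unitary operator and the
    partition of unity by the Fejer weights. *)
Lemma parseval_sum n (b : 'I_n.+1 -> 'I_n.+1 -> R[i]) :
  \sum_(j < n.+1) \sum_(k < n.+1) \sum_(l < n.+1)
    (\val (node j))^*%C ^+ k * \val (node j) ^+ l * b k l =
  n.+1%:R * \sum_k b k k.
Proof.
rewrite exchange_big /= mulr_sumr; apply: eq_bigr => k _.
rewrite exchange_big /=.
under eq_bigr => l _ do rewrite -mulr_suml character_sum.
rewrite (bigD1 k) //= eqxx mul1r big1 ?addr0 // => l lk.
by rewrite eq_sym (negPf lk) !mul0r.
Qed.

Section DiscreteFourier.
Context {V : lmodType R[i]}.
Implicit Types u : nat -> V.

(** The sum is not normalised; V is a Hilbert space or the field itself. *)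
Definition dft n (j : 'I_n.+1) u : V :=
  \sum_(k < n.+1) (\val (node j))^*%C ^+ k *: u k.

Lemma dft_linear n (j : 'I_n.+1) a u v :
  dft j (fun k => a *: u k + v k) = a *: dft j u + dft j v.
Proof.
rewrite /dft scaler_sumr -big_split; apply: eq_bigr => k _ /=.
by rewrite scalerDr !scalerA mulrC.
Qed.

(** Summation by parts: the shift becomes the multiplication by the node, up to
    a boundary term that does not grow with n. This is the source of all the
    convergence rates below. *)
Lemma dft_shift n (j : 'I_n.+1) u :
  dft j (fun k => u k.+1) - \val (node j) *: dft j u =
  \val (node j) *: (u n.+1 - u 0%N).
Proof.
set w := \val (node j).
have wJ : w * w^*%C = 1 by exact: circle_mulJ.
have wJn : w^*%C ^+ n.+1 = 1 by rewrite -rmorphXn node_expr rmorph1.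
have -> : dft j (fun k => u k.+1) =
    w *: \sum_(k < n.+1) w^*%C ^+ k.+1 *: u k.+1.
  rewrite scaler_sumr; apply: eq_bigr => k _.
  by rewrite scalerA exprS mulrA wJ mul1r.
rewrite -scalerBr -sumrB; congr (_ *: _).
rewrite -(big_mkord xpredT
  (fun k => w^*%C ^+ k.+1 *: u k.+1 - w^*%C ^+ k *: u k)).
by rewrite telescope_sumr // wJn expr0 !scale1r.
Qed.

End DiscreteFourier.

End RootsOfUnity.

(** * Continuous functions on the circle *)

Section CircleTopology.
Context {R : realType}.
Implicit Types (z w : circle R) (f g : circle R -> R[i]^o).

Lemma normr_lt_sqmod (a : R[i]) (e : R) : 0 < e ->
  (`|a| < e%:C) = (sqmod a < e ^+ 2).
Proof.
move=> e0; rewrite -ltcR sqmod_normr rmorphXn /= ltr_pXn2r //.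
by rewrite nnegrE ler0c ltW.
Qed.

Lemma cvg_sqmodP {T : Type} {F : set_system T} {FF : Filter F}
    (g : T -> R[i]^o) (l : R[i]^o) :
  g x @[x --> F] --> l <->
  forall e : R, 0 < e -> \forall x \near F, sqmod (g x - l) < e.
Proof.
split=> [/cvgrPdist_lt gl e e0|gl].
  have s0 : 0 < Num.sqrt e by rewrite sqrtr_gt0.
  have /gl : 0 < (Num.sqrt e)%:C by rewrite ltcR.
  apply: filterS => x; rewrite normr_lt_sqmod // sqr_sqrtr ?ltW //.
  by rewrite -sqmodN opprB.
apply/cvgrPdist_lt => -[a b]; rewrite ltcE /= => /andP[/eqP-> a0].
have := gl _ (exprn_gt0 2 a0); apply: filterS => x.
by rewrite -sqmodN opprB -normr_lt_sqmod.
Qed.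

Lemma near_circle z (e : R) : 0 < e ->
  \forall w \near z, sqmod (\val w - \val z) < e.
Proof.
move=> e0; have cval : continuous (\val : circle R -> R[i]^o).
  exact: initial_continuous.
exact: (cvg_sqmodP _ _).1 (cval z) _ e0.
Qed.

Lemma nbhs_circle z (A : set (circle R)) : nbhs z A ->
  exists2 d : R, 0 < d & forall w, sqmod (\val w - \val z) < d -> A w.
Proof.
move=> [_ [[W oW <-]] Wz WA].
have /nbhs_ballP[[a b] /=] := open_nbhs_nbhs (conj oW Wz).
rewrite ltcE /= => /andP[/eqP-> a0] aW.
exists (a ^+ 2); first exact: exprn_gt0.
move=> w wz; apply/WA/aW; rewrite -ball_normE /ball_ /=.
by rewrite normr_lt_sqmod // -sqmodN opprB.
Qed.

Lemma continuous_sqmodP f : continuous f <->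
  forall z (e : R), 0 < e -> \forall w \near z, sqmod (f w - f z) < e.
Proof.
split=> cf z; first by move: (cf z) => /cvg_sqmodP.
by apply: (@cvg_sqmodP _ _ (nbhs_filter z) _ _).2 => e e0; exact: cf.
Qed.

Lemma continuous_complex {T : topologicalType} (p q : T -> R) :
  continuous p -> continuous q -> continuous (fun t => p t +i* q t : R[i]^o).
Proof.
move=> cp cq t; apply: (@cvg_sqmodP _ _ (nbhs_filter t) _ _).2 => e e0.
have s0 : 0 < Num.sqrt (e / 2) by rewrite sqrtr_gt0 divr_gt0.
have pt := (@cvgrPdist_lt _ _ _ _ (nbhs_filter t) _ _).1 (cp t) _ s0.
have qt := (@cvgrPdist_lt _ _ _ _ (nbhs_filter t) _ _).1 (cq t) _ s0.
apply: filterS2 pt qt => s /ltr_normlP[p1 p2] /ltr_normlP[q1 q2].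
have := sqr_sqrtr (ltW (divr_gt0 e0 (ltr0Sn R 1))); rewrite /sqmod /=.
move: (Num.sqrt _) s0 p1 p2 q1 q2 => S S0 p1 p2 q1 q2 SE.
have p3 : 0 < (S + (p s - p t)) * (S - (p s - p t)) by rewrite mulr_gt0; lra.
have q3 : 0 < (S + (q s - q t)) * (S - (q s - q t)) by rewrite mulr_gt0; lra.
nra.
Qed.

Lemma continuous_circleP f z (e : R) : {for z, continuous f} -> 0 < e ->
  exists2 d : R, 0 < d &
    forall w, sqmod (\val w - \val z) < d -> sqmod (f w - f z) < e.
Proof. by move=> /cvg_sqmodP fz /fz /nbhs_circle. Qed.

Lemma continuous_lin (a : R[i]) f g : continuous f -> continuous g ->
  continuous (fun z => a * f z + g z : R[i]^o).
Proof.
by move=> cf cg z; apply: cvgD (cg z); apply: cvgM (cf z); exact: cvg_cst.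
Qed.

Lemma continuous_mul f g : continuous f -> continuous g ->
  continuous (fun z => f z * g z : R[i]^o).
Proof. by move=> cf cg z; apply: cvgM (cf z) (cg z). Qed.

Lemma continuous_conj f : continuous f ->
  continuous (fun z => (f z)^*%C : R[i]^o).
Proof.
move=> /continuous_sqmodP cf; apply/continuous_sqmodP => z e e0.
apply: filterS (cf z e e0) => w.
by rewrite -rmorphB sqmodJ.
Qed.

Lemma continuous_coord : continuous (fun z => \val z : R[i]^o).
Proof. exact: initial_continuous. Qed.

Lemma continuous_coordX k : continuous (fun z => \val z ^+ k : R[i]^o).
Proof.
elim: k => [|k IHk]; first exact: cst_continuous.
rewrite (_ : (fun z => _) = fun z => \val z * \val z ^+ k).
  by apply: continuous_mul IHk; exact: continuous_coord.
by apply/funext => z; rewrite exprS.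
Qed.

Lemma continuous_coordJX k : continuous (fun z => (\val z)^*%C ^+ k : R[i]^o).
Proof.
rewrite (_ : (fun z => _) = fun z => (\val z ^+ k)^*%C).
  exact/continuous_conj/continuous_coordX.
by apply/funext => z; rewrite rmorphXn.
Qed.

Lemma continuous_re f : continuous f -> continuous (fun z => complex.Re (f z)).
Proof.
move=> cf z; apply: (@cvgrPdist_lt _ _ _ _ (nbhs_filter z) _ _).2 => e e0.
apply: filterS ((continuous_sqmodP _).1 cf z _ (exprn_gt0 2 e0)) => w.
rewrite -[_ < e](@ltr_pXn2r _ 2) ?nnegrE ?(ltW e0) // real_normK ?num_real //.
apply: le_lt_trans; rewrite /sqmod raddfB /= -sqrrN opprB lerDl.
exact: sqr_ge0.
Qed.

Lemma continuous_im f : continuous f -> continuous (fun z => complex.Im (f z)).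
Proof.
move=> cf; have c0 : continuous (fun _ : circle R => 0 : R[i]^o).
  exact: cst_continuous.
have cif := @continuous_lin (- 'i) f _ cf c0.
rewrite (_ : (fun z => _) = fun z => complex.Re (- 'i * f z + 0)).
  exact: continuous_re cif.
by apply/funext => z; rewrite addr0; case: (f z) => a b /=; lra.
Qed.

Definition circle_exp (t : R) : circle R :=
  SigSub (mem_set (sqmod_circle (cos2Dsin2 t : sqmod (cos t +i* sin t) = 1))).

Lemma continuous_circle_exp : continuous circle_exp.
Proof.
apply: (@continuous_comp_initial _ _ _ _ circle_exp).
apply: (@continuous_complex _ (@cos R) (@sin R)); first exact: continuous_cos.
exact: continuous_sin.
Qed.

Lemma circle_exp_surj z : exists2 t, t \in `[- pi, pi] & circle_exp t = z.
Proof.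
have z1 := circle_sqmod z.
suff [t tpi tz] : exists2 t : R, t \in `[- pi, pi] & cos t +i* sin t = \val z.
  by exists t => //; apply: val_inj.
move: (\val z) z1 => [a b]; rewrite /sqmod /= => ab.
have aB : -1 <= a <= 1 by apply/andP; split; have := sqr_ge0 b; nra.
have ac := acos_ge0 aB; have ap := acos_lepi aB.
have ca : cos (acos a) = a by rewrite acosK // in_itv.
have sa : sin (acos a) = `|b|.
  by rewrite sin_acos // -ab addrAC subrr add0r sqrtr_sqr.
have [b0|b0] := leP 0 b.
- exists (acos a); last by rewrite ca sa ger0_norm.
  by rewrite in_itv /= ap andbT; have := pi_ge0 R; lra.
- exists (- acos a); last by rewrite cosN sinN ca sa ltr0_norm // opprK.
  by rewrite in_itv /=; have := pi_ge0 R => ?; apply/andP; split; lra.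
Qed.

(** The circle is the continuous image of a segment. *)
Lemma circle_compact : compact [set: circle R].
Proof.
have -> : [set: circle R] = circle_exp @` [set` `[- pi, pi]].
  rewrite eqEsubset; split=> // z _.
  by have [t tpi <-] := circle_exp_surj z; exists t.
apply: continuous_compact; last exact: segment_compact.
exact/continuous_subspaceT/continuous_circle_exp.
Qed.

Lemma continuous_bounded f : continuous f ->
  exists M : R, forall z, sqmod (f z) <= M.
Proof.
move=> cf; have /compact_near_coveringP := circle_compact.
pose P (M : R) z := sqmod (f z) <= M.
move=> /(_ _ (+oo : set_system R) P _); case.
- move=> z _; have /cvg_sqmodP/(_ _ ltr01) fz := cf z.
  pose Q := nbhs_pinfty_ge (num_real (2 * (1 + sqmod (f z)))).
  exists ([set w | sqmod (f w - f z) < 1],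
          [set M | 2 * (1 + sqmod (f z)) <= M]) => //= -[w M] /= [fw].
  apply: le_trans; rewrite -[f w](subrK (f z)).
  by apply: le_trans (sqmodD_le _ _) _; rewrite ler_pM2l // lerD2r ltW.
- by move=> M [_ /(_ (M + 1))]; rewrite ltrDl ltr01 => /(_ isT) fM;
    exists (M + 1) => z; exact: fM.
Qed.

(** The Heine-Cantor argument, on the near-covering form of compactness. *)
Lemma uniformly_continuous_circle f (e : R) : continuous f -> 0 < e ->
  exists2 d : R, 0 < d &
    forall z w, sqmod (\val w - \val z) < d -> sqmod (f w - f z) <= e.
Proof.
move=> cf e0; have /compact_near_coveringP := circle_compact.
pose P (d : R) z :=
  forall w, sqmod (\val w - \val z) < d -> sqmod (f w - f z) <= e.
move=> /(_ _ ((0 : R)^'+) P _) unif.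
have /unif : forall z, setT z -> \forall z' \near z & d \near (0:R)^'+, P d z'.
  move=> z _; have e4 : 0 < e / 4 by rewrite divr_gt0.
  have [d d0 dP] := continuous_circleP (cf z) e4.
  have d4 : 0 < d / 4 by rewrite divr_gt0.
  exists ([set w | sqmod (\val w - \val z) < d / 4], [set r | r < d / 4]) => /=.
    by split; [exact: near_circle | exact: nbhs_right_lt].
  move=> [z' r] /= [z'z rd] w wz'.
  have wz : sqmod (\val w - \val z) < d.
    have -> : \val w - \val z = (\val w - \val z') + (\val z' - \val z).
      by rewrite addrA subrK.
    by apply: le_lt_trans (sqmodD_le _ _) _; lra.
  have fz' : sqmod (f z' - f z) < e / 4 by apply: dP; lra.
  have -> : f w - f z' = (f w - f z) + - (f z' - f z).
    by rewrite opprB addrA subrK.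
  apply: le_trans (sqmodD_le _ _) _; rewrite sqmodN.
  by have := dP _ wz; lra.
move=> /= dP; near (0:R)^'+ => d; exists d => //.
by move=> z w; have := near dP d; apply.
Unshelve. all: by end_near. Qed.

(** The form of uniform continuity used by Korovkin-type arguments: far from the
    diagonal the oscillation is bounded by a multiple of the squared distance. *)
Lemma continuous_circle_quadratic f (e : R) : continuous f -> 0 < e ->
  exists2 C : R, 0 <= C &
    forall z w, sqmod (f w - f z) <= e + C * sqmod (\val w - \val z).
Proof.
move=> cf e0; have [M fM] := continuous_bounded cf.
have [d d0 dP] := uniformly_continuous_circle cf e0.
have M0 : 0 <= M := le_trans (sqmod_ge0 _) (fM (circle_exp 0)).
exists (4 * M / d); first by rewrite divr_ge0 ?mulr_ge0 // ltW.
move=> z w; have wz0 := sqmod_ge0 (\val w - \val z).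
have [wz|wz] := ltP (sqmod (\val w - \val z)) d.
  by rewrite (le_trans (dP _ _ wz)) // lerDl !mulr_ge0 ?invr_ge0 // ltW.
apply: (@le_trans _ _ (4 * M)).
  apply: le_trans (sqmodD_le _ _) _; rewrite sqmodN.
  by have := fM z; have := fM w; lra.
rewrite (le_trans _ (_ : 4 * M / d * sqmod (\val w - \val z) <= _)) //.
  by rewrite -mulrA ler_peMr ?mulr_ge0 // mulrC ler_pdivlMr // mul1r.
by rewrite lerDr ltW.
Qed.

End CircleTopology.

(** * Uniform density of trigonometric polynomials *)

Section Density.
Context {R : realType}.
Implicit Types (z w : circle R) (f g : circle R -> R[i]^o).

Lemma jensen (I : finType) (c : I -> R) (d : I -> R[i]) :
  (forall i, 0 <= c i) -> \sum_i c i = 1 ->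
  sqmod (\sum_i (c i)%:C * d i) <= \sum_i c i * sqmod (d i).
Proof.
move=> c0 c1.
have real_jensen (a : I -> R) :
    (\sum_i c i * a i) ^+ 2 <= \sum_i c i * a i ^+ 2.
  set m := \sum_i c i * a i; rewrite -subr_ge0.
  suff -> : \sum_i c i * a i ^+ 2 - m ^+ 2 = \sum_i c i * (a i - m) ^+ 2.
    by apply: sumr_ge0 => i _; rewrite mulr_ge0 ?sqr_ge0.
  transitivity (\sum_i (c i * a i ^+ 2 - 2 * m * (c i * a i) + m ^+ 2 * c i)).
    by rewrite big_split sumrB -!mulr_sumr -/m c1 /=; ring.
  by apply: eq_bigr => i _; ring.
have -> : \sum_i c i * sqmod (d i) =
    \sum_i c i * complex.Re (d i) ^+ 2 + \sum_i c i * complex.Im (d i) ^+ 2.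
  by rewrite -big_split; apply: eq_bigr => i _; rewrite /sqmod mulrDr.
rewrite /sqmod !raddf_sum /=.
apply: lerD; [have := real_jensen (fun i => complex.Re (d i))
             |have := real_jensen (fun i => complex.Im (d i))];
  apply: le_trans; rewrite le_eqVlt; apply/orP; left; apply/eqP;
  congr (_ ^+ 2); apply: eq_bigr => i _; case: (d i) => x y /=; ring.
Qed.

(** The Fejer kernel centred at a node, that is
    |sum_(k < N) (z / w_j) ^ k| ^ 2 / N ^ 2 with N = n + 1. *)
Definition fejer n (j : 'I_n.+1) z : R :=
  sqmod (dft j (fun k => \val z ^+ k : R[i]^o)) / n.+1%:R ^+ 2.

Lemma fejerE n (j : 'I_n.+1) z :
  (fejer j z)%:C = \sum_(k < n.+1) \sum_(l < n.+1)
    (\val (node j))^*%C ^+ k * \val (node j) ^+ l *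
      (\val z ^+ k * (\val z)^*%C ^+ l / n.+1%:R ^+ 2).
Proof.
rewrite /fejer rmorphM /= sqmodE fmorphV rmorphXn rmorph_nat /=.
rewrite /dft [X in _ * X / _]rmorph_sum /= mulr_suml mulr_suml.
apply: eq_bigr => k _; rewrite mulr_sumr mulr_suml; apply: eq_bigr => l _.
by rewrite [X in _ * X / _]rmorphM /= !rmorphXn /= conjcK /GRing.scale /=; ring.
Qed.

Lemma fejer_ge0 n (j : 'I_n.+1) z : 0 <= fejer j z.
Proof. by rewrite divr_ge0 ?sqmod_ge0 ?exprn_ge0. Qed.

Lemma fejer_sum n z : \sum_(j < n.+1) fejer j z = 1.
Proof.
apply: (@complexI R); rewrite rmorph_sum /=.
under eq_bigr do rewrite fejerE.
rewrite parseval_sum.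
under eq_bigr do rewrite -exprMn circle_mulJ expr1n.
by rewrite sumr_const card_ord -mulr_natr; field.
Qed.

(** (w_j - z) times the geometric sum telescopes to a boundary term of modulus at
    most 2, and there are n + 1 nodes against a factor (n + 1) ^ -2. *)
Lemma fejer_moment n z :
  \sum_(j < n.+1) fejer j z * sqmod (\val (node j) - \val z) <= 4 / n.+1%:R.
Proof.
apply: (@le_trans _ _ (\sum_(j < n.+1) 4 / n.+1%:R ^+ 2)); last first.
  rewrite sumr_const card_ord -mulr_natr le_eqVlt; apply/orP; left; apply/eqP.
  by field.
apply: ler_sum => j _; rewrite /fejer mulrAC ler_wpM2r ?invr_ge0 ?exprn_ge0 //.
rewrite mulrC -sqmodM.
have -> : (\val (node j) - \val z) * dft j (fun k => \val z ^+ k : R[i]^o) =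
    - (\val (node j) *: (\val z ^+ n.+1 - \val z ^+ 0 : R[i]^o)).
  rewrite -(dft_shift j (fun k => \val z ^+ k : R[i]^o)) opprB mulrBl.
  congr (_ - _); rewrite /dft mulr_sumr; apply: eq_bigr => k _.
  by rewrite /GRing.scale /= exprS; ring.
rewrite sqmodN sqmodM circle_sqmod mul1r.
apply: le_trans (sqmodD_le _ _) _; rewrite sqmodN !sqmodX circle_sqmod.
by rewrite !expr1n; lra.
Qed.

Definition interpolant n f : circle R -> R[i]^o :=
  fun z => \sum_(j < n.+1) (fejer j z)%:C * f (node j).

(** Korovkin: by convexity the error at z is at most the mean of the squared
    oscillations |f (w_j) - f (z)| ^ 2, which the quadratic moment controls. *)
Lemma interpolant_approx f (e : R) : continuous f -> 0 < e ->
  exists n, forall z, sqmod (f z - interpolant n f z) <= e.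
Proof.
move=> cf e0; have e2 : 0 < e / 2 by rewrite divr_gt0.
have [C C0 fC] := continuous_circle_quadratic cf e2.
have [n nP] : exists n : nat, C * 4 / n.+1%:R <= e / 2.
  exists (Num.truncn (C * 4 / (e / 2))); rewrite ler_pdivrMr // [leRHS]mulrC.
  by rewrite -ler_pdivrMr // ltW // truncnS_gt.
exists n => z.
have -> : f z - interpolant n f z =
    - \sum_(j < n.+1) (fejer j z)%:C * (f (node j) - f z).
  under eq_bigr do rewrite mulrBr.
  rewrite sumrB opprB -mulr_suml -(rmorph_sum (real_complex R)) /=.
  by rewrite fejer_sum mul1r.
rewrite sqmodN; apply: le_trans.
  exact: jensen (fun j => fejer_ge0 j z) (fejer_sum n z).
apply: (@le_trans _ _ (\sum_(j < n.+1) fejer j z *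
    (e / 2 + C * sqmod (\val (node j) - \val z)))).
  by apply: ler_sum => j _; rewrite ler_wpM2l ?fejer_ge0.
under eq_bigr do rewrite mulrDr [X in _ + X]mulrCA.
rewrite big_split /= -mulr_suml fejer_sum mul1r -mulr_sumr.
rewrite [leRHS](splitr e) lerD2l; apply: le_trans nP; rewrite -mulrA.
exact: ler_wpM2l C0 _ _ (fejer_moment n z).
Qed.

Lemma interpolant_span (P : set (circle R -> R[i]^o)) n f :
  (forall a g h, P g -> P h -> P (fun z => a * g z + h z)) ->
  (forall k l, P (fun z => \val z ^+ k * (\val z)^*%C ^+ l)) ->
  P (interpolant n f).
Proof.
move=> Plin Pmon.
have P0 : P (fun=> 0).
  have := Plin (-1) _ _ (Pmon 0%N 0%N) (Pmon 0%N 0%N).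
  by congr P; apply/funext => z; rewrite mulN1r addNr.
have Psum (I : Type) (r : seq I) (F : I -> circle R -> R[i]^o) :
    (forall i, P (F i)) -> P (fun z => \sum_(i <- r) F i z).
  move=> PF; elim: r => [|i r IHr].
    by move: P0; congr P; apply/funext => z; rewrite big_nil.
  have := Plin 1 _ _ (PF i) IHr.
  by congr P; apply/funext => z; rewrite big_cons mul1r.
have PZ a g : P g -> P (fun z => a * g z).
  move=> Pg; have := Plin a _ _ Pg P0.
  by congr P; apply/funext => z; rewrite addr0.
apply: (Psum _ (index_enum _) (fun j z => (fejer j z)%:C * f (node j))) => j.
pose c k l : R[i] := (\val (node j))^*%C ^+ k * \val (node j) ^+ l *
  f (node j) / n.+1%:R ^+ 2.
suff -> : (fun z => (fejer j z)%:C * f (node j)) = fun z : circle R =>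
    \sum_(k < n.+1) \sum_(l < n.+1) c k l * (\val z ^+ k * (\val z)^*%C ^+ l).
  by do 2 apply: (Psum _ _ _) => ?; exact: PZ.
apply/funext => z; rewrite fejerE mulr_suml; apply: eq_bigr => k _.
rewrite mulr_suml; apply: eq_bigr => l _; rewrite /c; ring.
Qed.

(** The density theorem as an induction principle: a property that passes to
    linear combinations and to uniform limits holds for all continuous functions
    if it holds for the integer powers of the coordinate. The negative powers are
    written with the conjugate. *)
Lemma continuous_circle_ind (P : set (circle R -> R[i]^o)) :
  (forall a g h, P g -> P h -> P (fun z => a * g z + h z)) ->
  (forall k, P (fun z => \val z ^+ k)) ->
  (forall k, P (fun z => (\val z)^*%C ^+ k)) ->
  (forall f, continuous f ->
    (forall e : R, 0 < e ->
      exists2 g, P g & forall z, sqmod (f z - g z) <= e) ->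
    P f) ->
  forall f, continuous f -> P f.
Proof.
move=> Plin Ppos Pneg Plim f cf; apply: Plim => // e e0.
have [n fn] := interpolant_approx cf e0; exists (interpolant n f) => //.
apply: interpolant_span => // k l; have [kl|/ltnW lk] := leqP k l.
  have := Pneg (l - k)%N; congr P; apply/funext => z.
  by rewrite -{2}(subnKC kl) exprD mulrA -exprMn circle_mulJ expr1n mul1r.
have := Ppos (k - l)%N; congr P; apply/funext => z.
by rewrite -{2}(subnK lk) exprD -mulrA -exprMn circle_mulJ expr1n mulr1.
Qed.

End Density.

(** * Approximate diagonalisation of a unitary operator *)

Section NullSequences.
Context {R : realType}.
Implicit Types u v : nat -> R.

Lemma null_le u v : (forall n, 0 <= u n <= v n) ->
  v n @[n --> \oo] --> (0 : R) -> u n @[n --> \oo] --> (0 : R).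
Proof.
by move=> uv v0; apply: squeeze_cvgr (cvg_cst 0) v0; apply: nearW.
Qed.

Lemma nullD u v (a b : R) :
  u n @[n --> \oo] --> (0 : R) -> v n @[n --> \oo] --> (0 : R) ->
  (a * u n + b * v n) @[n --> \oo] --> (0 : R).
Proof.
move=> u0 v0; rewrite -[X in _ --> X](_ : a * 0 + b * 0 = 0).
  by apply: cvgD; apply: cvgM => //; exact: cvg_cst.
by rewrite !mulr0 addr0.
Qed.

Lemma nullZ u (a : R) : u n @[n --> \oo] --> (0 : R) ->
  (a * u n) @[n --> \oo] --> (0 : R).
Proof.
by move=> u0; rewrite -(mulr0 a); apply: cvgM => //; exact: cvg_cst.
Qed.

Lemma null_ub u (a : R) : u n @[n --> \oo] --> (0 : R) ->
  (forall n, a <= u n) -> a <= 0.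
Proof.
move=> /cvgrPdist_lt u0 au; rewrite leNgt; apply/negP => a0.
have [n _ /(_ n (leqnn n))] := u0 _ a0; rewrite sub0r normrN.
by rewrite ltNge (le_trans (au n)) // ler_norm.
Qed.

End NullSequences.

Section UnitaryOperators.
Context {R : realType} {K : hilbertType R}.
Implicit Types (A U : 'B(K)) (x y : K).

(** A vector y for which the functional inner (A _) y had no representative would
    be sent to 0 by adjoint A, and then y = A 0 = 0, which has one. So the Riesz
    vectors of A exist as soon as adjoint A is a right inverse of A. *)
Lemma adjoint_cancel A : cancel (adjoint A) A ->
  forall x y, inner (A x) y = inner x (adjoint A y).
Proof.
move=> AK x y.
have [ex|nex] :=
  pselect (exists z, [set z | forall x, inner (A x) y = inner x z] z).
  exact: (xgetPex 0 ex x).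
suff y0 : y = 0 by case: nex; exists 0 => w; rewrite y0 !linear0r.
rewrite -(AK y) /adjoint xgetPN ?linear0 // => z zP; apply: nex.
by exists z.
Qed.

Lemma eq_adjoint (A B : 'B(K)) : A =1 B -> adjoint A =1 adjoint B.
Proof. by move=> /funext AB y; rewrite /adjoint AB. Qed.

Lemma unitary_inner U : unitary_operator U ->
  forall x y, inner (U x) (U y) = inner x y.
Proof. by move=> [UK KU] x y; rewrite adjoint_cancel // UK. Qed.

Lemma unitary_iter U : unitary_operator U ->
  forall k x y, inner (iter k U x) (iter k U y) = inner x y.
Proof. by move=> uU; elim=> //= k IHk x y; rewrite unitary_inner. Qed.

End UnitaryOperators.

Section Calculus.
Context {R : realType} {K : hilbertType R} (U : 'B(K)).
Hypothesis uU : unitary_operator U.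
Implicit Types (x y : K) (z : circle R) (f g : circle R -> R[i]^o).

(** S_j x in the notation of the opening comment. *)
Definition orbit_dft n (j : 'I_n.+1) x : K := dft j (fun k => iter k U x).

Lemma orbit_dft_linear n (j : 'I_n.+1) a x y :
  orbit_dft j (a *: x + y) = a *: orbit_dft j x + orbit_dft j y.
Proof.
rewrite -dft_linear; congr dft; apply/funext => k.
by elim: k => //= k ->; rewrite linearP.
Qed.

Lemma orbit_dftB n (j : 'I_n.+1) x y :
  orbit_dft j (x - y) = orbit_dft j x - orbit_dft j y.
Proof. by rewrite addrC -scaleN1r orbit_dft_linear scaleN1r addrC. Qed.

(** The frame x |-> (S_j x / N)_j is isometric: by orthogonality of characters
    only the diagonal terms inner (U ^ k x) (U ^ k y) = inner x y survive. *)
Lemma orbit_dft_inner n x y :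
  \sum_(j < n.+1) inner (orbit_dft j x) (orbit_dft j y) =
  (n.+1%:R ^+ 2) * inner x y.
Proof.
transitivity (\sum_(j < n.+1) \sum_(k < n.+1) \sum_(l < n.+1)
    (\val (node j))^*%C ^+ k * \val (node j) ^+ l *
    inner (iter k U x) (iter l U y)).
  apply: eq_bigr => j _; rewrite /orbit_dft /dft; move: (\val (node j)) => c.
  rewrite linear_sumlz /=; apply: eq_bigr => k _.
  rewrite innerZl linear_sumr /= mulr_sumr; apply: eq_bigr => l _.
  rewrite innerZr [(_ ^+ l)^*%C]rmorphXn /= conjcK; exact: mulrA.
rewrite parseval_sum; under eq_bigr do rewrite unitary_iter //.
by rewrite sumr_const card_ord -[X in _ * X]mulr_natl mulrA expr2.
Qed.

(** The squared norm in K ^ N, normalised so that the frame is isometric. *)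
Definition energy n (v : 'I_n.+1 -> K) : R :=
  (\sum_(j < n.+1) sqn (v j)) / n.+1%:R ^+ 2.

Lemma energy_ge0 n (v : 'I_n.+1 -> K) : 0 <= energy v.
Proof. by rewrite divr_ge0 ?exprn_ge0 ?sumr_ge0 // => j _; rewrite sqn_ge0. Qed.

Lemma energy_le n (v : 'I_n.+1 -> K) (w : 'I_n.+1 -> K) (C : R) :
  (forall j, sqn (v j) <= C * sqn (w j)) -> energy v <= C * energy w.
Proof.
move=> vw; rewrite /energy mulrA ler_wpM2r ?invr_ge0 ?exprn_ge0 // mulr_sumr.
exact: ler_sum.
Qed.

Lemma energyD_le n (v w : 'I_n.+1 -> K) :
  energy (fun j => v j + w j) <= 2 * (energy v + energy w).
Proof.
rewrite /energy -mulrDl mulrA ler_wpM2r ?invr_ge0 ?exprn_ge0 //.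
rewrite -big_split mulr_sumr; apply: ler_sum => j _; exact: sqnD_le.
Qed.

Lemma energy_orbit_dft n x : energy (fun j : 'I_n.+1 => orbit_dft j x) = sqn x.
Proof.
apply: (@complexI R); rewrite /energy rmorphM rmorph_sum /=.
under eq_bigr do rewrite sqnE.
rewrite orbit_dft_inner fmorphV rmorphXn rmorph_nat /= mulrAC divff //.
by rewrite mul1r sqnE.
Qed.

Definition defect f x y n : R :=
  energy (fun j : 'I_n.+1 => orbit_dft j y - f (node j) *: orbit_dft j x).

(** The relation y = f(U) x: multiplication by the values of f at the nodes sends
    the frame coefficients of x to those of y, asymptotically. *)
Definition acts f x y := defect f x y n @[n --> \oo] --> (0 : R).

Lemma acts_linear a f g x y y' :
  acts f x y -> acts g x y' -> acts (fun z => a * f z + g z) x (a *: y + y').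
Proof.
move=> fy gy'; apply: null_le (nullD (2 * sqmod a) 2 fy gy') => n.
rewrite energy_ge0 /= -mulrA -mulrDr.
have -> : defect (fun z => a * f z + g z) x (a *: y + y') n =
    energy (fun j : 'I_n.+1 =>
      a *: (orbit_dft j y - f (node j) *: orbit_dft j x) +
      (orbit_dft j y' - g (node j) *: orbit_dft j x)).
  congr energy; apply/funext => j; rewrite orbit_dft_linear scalerDl -scalerA.
  by rewrite scalerBr opprD addrACA.
apply: le_trans (energyD_le _ _) _; rewrite ler_pM2l // lerD2r.
by apply: energy_le => j; rewrite sqnZ.
Qed.

Lemma acts_vec a f x y x' y' :
  acts f x y -> acts f x' y' -> acts f (a *: x + x') (a *: y + y').
Proof.
move=> fy fy'; apply: null_le (nullD (2 * sqmod a) 2 fy fy') => n.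
rewrite energy_ge0 /= -mulrA -mulrDr.
have -> : defect f (a *: x + x') (a *: y + y') n =
    energy (fun j : 'I_n.+1 =>
      a *: (orbit_dft j y - f (node j) *: orbit_dft j x) +
      (orbit_dft j y' - f (node j) *: orbit_dft j x')).
  congr energy; apply/funext => j; rewrite !orbit_dft_linear scalerDr scalerBr.
  by rewrite !scalerA (mulrC a) opprD addrACA.
apply: le_trans (energyD_le _ _) _; rewrite ler_pM2l // lerD2r.
by apply: energy_le => j; rewrite sqnZ.
Qed.

Lemma acts_mul (M : R) f g x y w : (forall z, sqmod (f z) <= M) ->
  acts g x y -> acts f y w -> acts (fun z => f z * g z) x w.
Proof.
move=> fM gy fw; apply: null_le (nullD 2 (2 * M) fw gy) => n.
rewrite energy_ge0 /= -mulrA -mulrDr.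
have -> : defect (fun z => f z * g z) x w n =
    energy (fun j : 'I_n.+1 =>
      (orbit_dft j w - f (node j) *: orbit_dft j y) +
      f (node j) *: (orbit_dft j y - g (node j) *: orbit_dft j x)).
  congr energy; apply/funext => j.
  by rewrite scalerBr scalerA addrA subrK.
apply: le_trans (energyD_le _ _) _; rewrite ler_pM2l // lerD2l.
by apply: energy_le => j; rewrite sqnZ ler_wpM2r ?sqn_ge0.
Qed.

Lemma acts_one x : acts (fun=> 1) x x.
Proof.
rewrite /acts (_ : defect _ _ _ = fun=> 0); first exact: cvg_cst.
apply/funext => n; rewrite /defect /energy big1 ?mul0r // => j _.
by rewrite scale1r subrr sqn0.
Qed.

(** The boundary term of dft_shift has squared norm at most 4 sqn x at each of the
    n + 1 nodes. *)
Lemma acts_coord x : acts (fun z => \val z) x (U x).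
Proof.
apply: null_le (nullZ (4 * sqn x) cvg_harmonic) => n; rewrite energy_ge0 /=.
have -> : 4 * sqn x * n.+1%:R^-1 =
    (\sum_(j < n.+1) 4 * sqn x) / n.+1%:R ^+ 2.
  by rewrite sumr_const card_ord -mulr_natr; field.
rewrite /defect /energy ler_wpM2r ?invr_ge0 ?exprn_ge0 //.
apply: ler_sum => j _.
have -> : orbit_dft j (U x) = dft j (fun k => iter k.+1 U x).
  by rewrite /orbit_dft; congr dft; apply/funext => k; rewrite iterSr.
rewrite dft_shift sqnZ circle_sqmod mul1r; apply: le_trans (sqnB_le _ _) _.
by rewrite /sqn unitary_iter // -/(sqn x); lra.
Qed.

(** At each node the defect of the pair (x, U^-1 x) for the conjugate coordinate
    is a unimodular multiple of that of (U^-1 x, x) for the coordinate. *)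
Lemma acts_coordJ x : acts (fun z => (\val z)^*%C) x (adjoint U x).
Proof.
have := acts_coord (adjoint U x); rewrite (uU.2 x) /acts.
suff -> : defect (fun z => (\val z)^*%C) x (adjoint U x) =
    defect (fun z => \val z) (adjoint U x) x by [].
apply/funext => n; rewrite /defect /energy; congr (_ / _).
apply: eq_bigr => j _; set w := \val (node j).
have -> : orbit_dft j (adjoint U x) - w^*%C *: orbit_dft j x =
    - w^*%C *: (orbit_dft j x - w *: orbit_dft j (adjoint U x)).
  rewrite scalerBr scalerA !scaleNr mulNr scaleNr opprK (mulrC _ w).
  by rewrite circle_mulJ scale1r addrC.
by rewrite sqnZ sqmodN sqmodJ circle_sqmod mul1r.
Qed.

Lemma eq_acts f g x y : f =1 g -> acts f x y -> acts g x y.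
Proof. by move=> /funext ->. Qed.

Lemma acts_expr k x : acts (fun z => \val z ^+ k) x (iter k U x).
Proof.
elim: k => [|k IHk]; first exact: eq_acts (acts_one x).
have val_le1 z : sqmod (\val z) <= 1 by rewrite circle_sqmod.
apply: eq_acts (acts_mul val_le1 IHk (acts_coord _)) => z.
by rewrite exprS.
Qed.

Lemma acts_exprJ k x :
  acts (fun z => (\val z)^*%C ^+ k) x (iter k (adjoint U) x).
Proof.
elim: k => [|k IHk]; first exact: eq_acts (acts_one x).
have conj_le1 z : sqmod (\val z)^*%C <= 1 by rewrite sqmodJ circle_sqmod.
apply: eq_acts (acts_mul conj_le1 IHk (acts_coordJ _)) => z.
by rewrite exprS.
Qed.

(** Since the frame is isometric, y has the asymptotic norm of the sequence
    f (w_j) S_j x. The factor 2 comes from energyD_le. *)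
Lemma acts_bound (M : R) f x y : (forall z, sqmod (f z) <= M) ->
  acts f x y -> sqn y <= 2 * M * sqn x.
Proof.
move=> fM /(nullZ 2) fy; rewrite -subr_le0; apply: null_ub fy _ => n.
rewrite lerBlDr -mulrA -mulrDr -{1}(energy_orbit_dft n y).
have -> : (fun j : 'I_n.+1 => orbit_dft j y) =
    (fun j => (orbit_dft j y - f (node j) *: orbit_dft j x) +
              f (node j) *: orbit_dft j x).
  by apply/funext => j; rewrite subrK.
apply: le_trans (energyD_le _ _) _; rewrite ler_pM2l // lerD2l.
rewrite -(energy_orbit_dft n x); apply: energy_le => j.
by rewrite sqnZ ler_wpM2r ?sqn_ge0.
Qed.

Lemma acts_uniq f x y y' : acts f x y -> acts f x y' -> y = y'.
Proof.
move=> fy fy'; have := acts_linear (-1) fy fy'.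
have f0 z : sqmod (-1 * f z + f z) <= 0.
  by rewrite mulN1r addNr (sqmod_real 0) expr0n.
move=> /(acts_bound f0); rewrite mulr0 mul0r scaleN1r => yy'.
apply/esym/eqP; rewrite -subr_eq0 addrC; apply/eqP/sqn_eq0/eqP.
by rewrite eq_le yy' sqn_ge0.
Qed.

(** The values of f(U) x along a uniform approximation g_n of f form a Cauchy
    sequence by acts_bound; their limit is related to x because the frame is
    isometric. *)
Lemma acts_exists f x : continuous f -> exists y, acts f x y.
Proof.
move: f; apply: (@continuous_circle_ind _ (fun f => exists y, acts f x y)).
- move=> a g h [y gy] [y' hy'].
  by exists (a *: y + y'); exact: acts_linear.
- by move=> k; exists (iter k U x); exact: acts_expr.
- by move=> k; exists (iter k (adjoint U) x); exact: acts_exprJ.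
move=> f _ fapprox.
have /choice[gy gyP] : forall n : nat, exists gy : (circle R -> R[i]^o) * K,
    acts gy.1 x gy.2 /\ forall z, sqmod (f z - gy.1 z) <= harmonic n.
  move=> n; have [g [y gy] fg] := fapprox _ (harmonic_gt0 n).
  by exists (g, y).
pose g n := (gy n).1; pose y n := (gy n).2.
have gyn n : acts (g n) x (y n) by have [] := gyP n.
have fg n z : sqmod (f z - g n z) <= harmonic n by have [_] := gyP n.
have [w yw] : exists w, sqn (y n - w) @[n --> \oo] --> (0 : R).
  apply: (@sqn_cauchy _ _ _ (fun n => 4 * sqn x * harmonic n)).
    exact/nullZ/cvg_harmonic.
  move=> m n; have := acts_linear (-1) (gyn n) (gyn m).
  have M z : sqmod (-1 * g n z + g m z) <= 2 * (harmonic m + harmonic n).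
    have -> : -1 * g n z + g m z = (f z - g n z) + - (f z - g m z).
      by rewrite opprB mulN1r [RHS]addrC subrKA addrC.
    apply: le_trans (sqmodD_le _ _) _; rewrite sqmodN ler_pM2l //.
    by rewrite [leRHS]addrC lerD.
  by move=> /(acts_bound M); rewrite scaleN1r addrC; lra.
exists w; apply/cvgrPdist_lt => e e0.
have [m ym fm] : exists2 m, sqn (y m - w) < e / 8 &
    sqn x * harmonic m < e / 16.
  have e8 : 0 < e / 8 by rewrite divr_gt0.
  have e16 : 0 < e / 16 by rewrite divr_gt0.
  have xh := nullZ (sqn x) cvg_harmonic.
  have /cvgrPdist_lt/(_ _ e8) h1 := yw.
  have /cvgrPdist_lt/(_ _ e16) h2 := xh.
  have [m _ /(_ m (leqnn m)) [m1 m2]] := filterI h1 h2.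
  by exists m; [move: m1|move: m2]; rewrite sub0r normrN;
    apply: le_lt_trans; rewrite ler_norm.
have e16 : 0 < e / 16 by rewrite divr_gt0.
have /cvgrPdist_lt/(_ _ e16) := gyn m; apply: filterS => n.
rewrite !sub0r !normrN !ger0_norm ?energy_ge0 // => gm.
(* The three terms are small by the choice of m, by the choice of n, and because
   g_m is uniformly close to f. *)
have -> : defect f x w n = energy (fun j : 'I_n.+1 =>
    orbit_dft j (w - y m) +
    ((orbit_dft j (y m) - g m (node j) *: orbit_dft j x) +
     (g m (node j) - f (node j)) *: orbit_dft j x)).
  congr energy; apply/funext => j.
  by rewrite orbit_dftB scalerBl !addrA !subrK.
apply: le_lt_trans (energyD_le _ _) _; rewrite energy_orbit_dft sqnBC.
set E := energy _.
have : E <= 2 * (defect (g m) x (y m) n + harmonic m * sqn x).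
  apply: le_trans (energyD_le _ _) _; rewrite ler_pM2l // lerD2l.
  rewrite -(energy_orbit_dft n x); apply: energy_le => j.
  by rewrite sqnZ ler_wpM2r ?sqn_ge0 // -sqmodN opprB fg.
lra.
Qed.

End Calculus.

(** * Existence of the functional calculus *)

Section BoundedOperators.
Context {R : realType} {H K : hilbertType R}.

Lemma linear_bounded_operator (b : H -> K) (C : R) :
  linear b -> (forall x, sqn (b x) <= C * sqn x) ->
  exists B : bounded_operator H K, B =1 b.
Proof.
move=> blin bC.
pose bL := GRing.isLinear.Build R[i] H K *:%R b blin.
pose B : {linear H -> K} := HB.pack b bL.
suff cB : continuous B by exists (BoundedOperator cB).
move=> x; apply/cvgrPdist_lt => -[e1 e2].
rewrite ltcE /= => /andP[/eqP-> e0].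
pose d := e1 / Num.sqrt (`|C| + 1).
have C0 : 0 < `|C| + 1 by rewrite ltr_wpDl.
have d0 : 0 < d by rewrite divr_gt0 ?sqrtr_gt0.
have d0C : 0 < d%:C by rewrite ltcR.
apply: filterS (nbhsx_ballx x _ d0C) => y; rewrite -ball_normE /ball_ /= => xy.
rewrite -[_ +i* _]/(e1%:C) (_ : B x - B y = b (x - y)); last first.
  exact/esym/(raddfB B).
rewrite -(@ltr_pXn2r _ 2) ?nnegrE ?normr_ge0 ?ler0c ?ltW // in xy.
rewrite -(@ltr_pXn2r _ 2) ?nnegrE ?normr_ge0 ?ler0c ?(ltW e0) //.
rewrite -sqn_normr -rmorphXn ltcR in xy; rewrite -sqn_normr -rmorphXn ltcR.
apply: le_lt_trans (bC _) _.
have [x0|x0] := eqVneq (sqn (x - y)) 0; first by rewrite x0 mulr0 exprn_gt0.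
have xpos : 0 < sqn (x - y) by rewrite lt_neqAle eq_sym x0 sqn_ge0.
apply: (@lt_trans _ _ ((`|C| + 1) * sqn (x - y))).
  by rewrite ltr_pM2r // ltr_pwDr // ler_norm.
by rewrite mulrC -ltr_pdivlMr //; move: xy; rewrite /d expr_div_n sqr_sqrtr.
Qed.

End BoundedOperators.

Section CalculusExistence.
Context {R : realType} {K : hilbertType R} (U : 'B(K)).
Hypothesis uU : unitary_operator U.
Implicit Types (x y : K) (z : circle R) (f g : circle R -> R[i]^o).

(** Multiplications by conjugate sequences are adjoint to each other in K ^ N, and
    the frame is isometric, so both sides are limits of the same inner products.
    Signs are dealt with first: the real part of the difference D is at most 0,
    also after multiplication of the second pair by D, which makes the difference
    equal to the squared modulus of D. *)
Lemma acts_adjoint f x y x' y' :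
  acts U f x y -> acts U (fun z => (f z)^*%C) x' y' ->
  inner y x' = inner x y'.
Proof.
move=> fy fy'.
have ReM (r : R) (c : R[i]) : complex.Re (r%:C * c) = r * complex.Re c.
  by case: c => c1 c2 /=; rewrite mul0r subr0.
have half v v' : acts U (fun z => (f z)^*%C) v v' ->
    complex.Re (inner y v - inner x v') <= 0.
  move=> fv; rewrite leNgt; apply/negP.
  set D := complex.Re _ => D0; pose s := sqn v + sqn x.
  have s0 : 0 <= s by rewrite addr_ge0 ?sqn_ge0.
  (* Young parameter: small enough for the term t * s, which does not vanish with
     n, to be absorbed by D. *)
  have [t t0 ts] : exists2 t, 0 < t & 2 * (t * s) = D - 2 * t.
    exists (D / (2 * (s + 1))).
      by rewrite divr_gt0 // mulr_gt0 // ltr_wpDl.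
    by field; rewrite gt_eqF // ltr_wpDl.
  suff : D - t * s <= 0 by lra.
  apply: null_ub (nullD t^-1 t^-1 fy fv) _ => n.
  rewrite lerBlDr.
  pose N2 : R := n.+1%:R ^+ 2.
  have N0 : 0 < N2 by rewrite exprn_gt0.
  have -> : D = (\sum_(j < n.+1)
      (complex.Re (inner (orbit_dft U j y - f (node j) *: orbit_dft U j x)
                         (orbit_dft U j v)) +
       complex.Re (inner (- orbit_dft U j x)
         (orbit_dft U j v' - (f (node j))^*%C *: orbit_dft U j v)))) / N2.
    apply: (mulIf (lt0r_neq0 N0)); rewrite divfK ?lt0r_neq0 //.
    transitivity (complex.Re ((n.+1%:R ^+ 2) * (inner y v - inner x v'))).
      have -> : n.+1%:R ^+ 2 = N2%:C :> R[i] by rewrite rmorphXn rmorph_nat.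
      by rewrite ReM mulrC.
    rewrite mulrBr -!(orbit_dft_inner uU) -sumrB raddf_sum /=.
    apply: eq_bigr => j _; rewrite -raddfD; congr complex.Re.
    rewrite !(innerDl, innerDr, innerNl, innerNr, innerZl, innerZr) conjcK.
    by ring.
  rewrite /s -(energy_orbit_dft uU n v) -(energy_orbit_dft uU n x).
  rewrite /defect /energy.
  rewrite ler_pdivrMr //; apply: (@le_trans _ _ (\sum_(j < n.+1)
      (t^-1 * sqn (orbit_dft U j y - f (node j) *: orbit_dft U j x) +
       t^-1 * sqn (orbit_dft U j v' - (f (node j))^*%C *: orbit_dft U j v) +
       t * (sqn (orbit_dft U j v) + sqn (orbit_dft U j x))))); last first.
    rewrite !big_split /= -!mulr_sumr big_split /= /N2.
    rewrite le_eqVlt; apply/orP; left; apply/eqP; field.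
    by rewrite nat1r pnatr_eq0 /= lt0r_neq0.
  apply: ler_sum => j _.
  have tV : 0 < t^-1 by rewrite invr_gt0.
  set a := _ - _; set b := orbit_dft U j v; set c := orbit_dft U j x.
  set d := _ - _.
  by have := young a b tV; have := young (- c) d t0; rewrite invrK sqnN; lra.
set D := inner y x' - inner x y'.
suff : D = 0 by move/eqP; rewrite subr_eq0 => /eqP.
apply: sqmod_eq0; apply/eqP; rewrite eq_le sqmod_ge0 andbT.
have a0 : acts U (fun z => (f z)^*%C) 0 0.
  have := acts_vec (-1) fy' fy'; by rewrite !scaleN1r !addNr.
have := half _ _ (acts_vec D fy' a0); rewrite !addr0 !innerZr -mulrBr -/D.
by rewrite mulrC -sqmodE.
Qed.

Lemma acts_operator f : continuous f ->
  exists B : 'B(K), forall x, acts U f x (B x).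
Proof.
move=> cf; have [b bP] := choice (fun x => acts_exists uU x cf).
have [M fM] := continuous_bounded cf.
have blin : linear b.
  by move=> a x y; apply: (acts_uniq uU (bP _)); exact: acts_vec.
have [B Bb] := linear_bounded_operator blin (fun x => acts_bound uU fM (bP x)).
by exists B => x; rewrite Bb.
Qed.

Definition spectral_operator f : 'B(K) :=
  xget (zero_operator K K) [set B : 'B(K) | forall x, acts U f x (B x)].

Lemma spectral_operatorP f x : continuous f ->
  acts U f x (spectral_operator f x).
Proof.
by move=> cf; exact: (xgetPex (zero_operator K K) (acts_operator cf) x).
Qed.

Lemma spectral_operatorE f x y : continuous f -> acts U f x y ->
  spectral_operator f x = y.
Proof. by move=> cf; apply: acts_uniq => //; exact: spectral_operatorP. Qed.

Lemma functional_calculus_exists : is_functional_calculus U spectral_operator.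
Proof.
split.
- move=> x; apply: spectral_operatorE; first exact: cst_continuous.
  exact: acts_one.
- move=> x; apply: spectral_operatorE; first exact: continuous_coord.
  exact: acts_coord.
- move=> a f g cf cg x; apply: spectral_operatorE; first exact: continuous_lin.
  by apply: acts_linear; exact: spectral_operatorP.
- move=> f g cf cg x; apply: spectral_operatorE; first exact: continuous_mul.
  have [M fM] := continuous_bounded cf.
  exact: acts_mul fM (spectral_operatorP _ cg) (spectral_operatorP _ cf).
- move=> f cf x; set y := spectral_operator _ x.
  have fy : acts U (fun z => (f z)^*%C) x y.
    exact/spectral_operatorP/continuous_conj.
  have adj w : inner (spectral_operator f w) x = inner w y.
    exact: acts_adjoint (spectral_operatorP _ cf) fy.
  rewrite /adjoint; case: xgetP => [z zE zP|]; last by move/(_ y); case.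
  apply/eqP; rewrite -subr_eq0; apply/eqP/sqn_eq0; rewrite /sqn innerDr innerNr.
  by rewrite -adj zP subrr.
Qed.

End CalculusExistence.

(** * Boundedness of functional calculi, orthogonal projections *)

Section CalculusBound.
Context {R : realType} {K : hilbertType R} (U : 'B(K)).
Context (Phi : (circle R -> R[i]^o) -> 'B(K)).
Hypothesis PhiP : is_functional_calculus U Phi.
Implicit Types (x y : K) (z : circle R) (f g u : circle R -> R[i]^o).

Lemma calculus_one x : Phi (fun=> 1) x = x.
Proof. by case: PhiP. Qed.

Lemma calculus_coord x : Phi (fun z => \val z) x = U x.
Proof. by case: PhiP. Qed.

Lemma calculus_linear a f g x : continuous f -> continuous g ->
  Phi (fun z => a * f z + g z) x = a *: Phi f x + Phi g x.
Proof. by case: PhiP => _ _ + _ _ cf cg; apply. Qed.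

Lemma calculus_mul f g x : continuous f -> continuous g ->
  Phi (fun z => f z * g z) x = Phi f (Phi g x).
Proof. by case: PhiP => _ _ _ + _ cf cg; apply. Qed.

Lemma calculus_adjoint f x : continuous f ->
  Phi (fun z => (f z)^*%C) x = adjoint (Phi f) x.
Proof. by case: PhiP => _ _ _ _ + cf; apply. Qed.

Lemma calculus_coordX k x : Phi (fun z => \val z ^+ k) x = iter k U x.
Proof.
elim: k => [|k IHk]; first exact: calculus_one.
rewrite iterS -IHk -calculus_coord -calculus_mul.
- by congr (Phi _ x); apply/funext => z; rewrite exprS.
- exact: continuous_coord.
- exact: continuous_coordX.
Qed.

Lemma calculus_coordJX k x :
  Phi (fun z => (\val z)^*%C ^+ k) x = iter k (adjoint U) x.
Proof.
elim: k => [|k IHk]; first exact: calculus_one.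
have adjU y : adjoint U y = Phi (fun z => (\val z)^*%C) y.
  rewrite calculus_adjoint; last exact: continuous_coord.
  by apply: eq_adjoint => w; rewrite calculus_coord.
rewrite iterS -IHk adjU -calculus_mul.
- by congr (Phi _ x); apply/funext => z; rewrite exprS.
- exact/continuous_conj/continuous_coord.
- exact: continuous_coordJX.
Qed.

(** The calculus maps the conjugate of u to an inverse of Phi u, so
    adjoint_cancel applies to Phi u. *)
Lemma calculus_unimodular u x : continuous u -> (forall z, sqmod (u z) = 1) ->
  sqn (Phi u x) = sqn x.
Proof.
move=> cu u1; have cJ := continuous_conj cu.
have uK y : Phi u (adjoint (Phi u) y) = y.
  rewrite -calculus_adjoint // -calculus_mul // -[RHS]calculus_one.
  by congr (Phi _ y); apply/funext => z; rewrite -sqmodE u1.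
rewrite /sqn (adjoint_cancel uK) -calculus_adjoint // -calculus_mul //.
congr (complex.Re (inner x _)); rewrite -[RHS]calculus_one.
by congr (Phi _ x); apply/funext => z; rewrite mulrC -sqmodE u1.
Qed.

(** Continuity of f is included since linearity of Phi is only assumed for
    continuous functions. *)
Definition calculus_le (C : R) f :=
  continuous f /\ forall x, sqn (Phi f x) <= C * sqn x.

Lemma calculus_le_linear C D a f g : calculus_le C f -> calculus_le D g ->
  calculus_le (2 * (sqmod a * C + D)) (fun z => a * f z + g z).
Proof.
move=> [cf fC] [cg gD]; split=> [|x]; first exact: continuous_lin.
rewrite calculus_linear //; apply: le_trans (sqnD_le _ _) _.
rewrite -mulrA ler_pM2l // mulrDl lerD // sqnZ -mulrA.
by rewrite ler_wpM2l ?sqmod_ge0.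
Qed.

(** 2 p is the sum of p + i sqrt (1 - p ^ 2) and of its conjugate, both of
    modulus 1. *)
Lemma calculus_le_real (p : circle R -> R) :
  continuous p -> (forall z, p z ^+ 2 <= 1) ->
  calculus_le 4 (fun z => (2 * p z)%:C).
Proof.
move=> cp p1; pose u z : R[i]^o := p z +i* Num.sqrt (1 - p z ^+ 2).
have u1 z : sqmod (u z) = 1.
  by rewrite /sqmod /= sqr_sqrtr ?subr_ge0 // addrC subrK.
have cu : continuous u.
  apply: continuous_complex => // z.
  apply: (@continuous_comp _ _ _ p (fun t => Num.sqrt (1 - t ^+ 2))).
    exact: cp.
  apply: (@continuous_comp _ _ _ (fun t : R => 1 - t ^+ 2) Num.sqrt).
    by apply: cvgB; [exact: cvg_cst | exact: exprn_continuous].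
  exact: sqrt_continuous.
have u_le1 : calculus_le 1 u.
  by split=> // x; rewrite mul1r calculus_unimodular.
have uJ_le1 : calculus_le 1 (fun z => (u z)^*%C).
  have := continuous_conj cu; set v := fun z => _ => cv.
  have v1 z : sqmod (v z) = 1 by rewrite sqmodJ.
  by split=> // x; rewrite mul1r (calculus_unimodular _ cv v1).
have := calculus_le_linear 1 u_le1 uJ_le1.
rewrite (sqmod_real 1) expr1n mulr1 (_ : 2 * (1 + 1) = 4); last by lra.
congr calculus_le; apply/funext => z; rewrite mul1r /u /=.
by apply/eqP; rewrite eq_complex /= subrr eqxx andbT; apply/eqP; lra.
Qed.

(** The real and imaginary parts of f / sqrt M take values in [-1, 1]. *)
Lemma calculus_bound (M : R) f x : continuous f ->
  (forall z, sqmod (f z) <= M) -> 0 < M -> sqn (Phi f x) <= 6 * M * sqn x.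
Proof.
move=> cf fM M0; pose s := Num.sqrt M.
have s0 : 0 < s by rewrite sqrtr_gt0.
have sM : s ^+ 2 = M by rewrite sqr_sqrtr // ltW.
have p_le (p : circle R -> R) : continuous p ->
    (forall z, p z ^+ 2 <= M) -> calculus_le 4 (fun z => (2 * (s^-1 * p z))%:C).
  move=> cp pM; apply: calculus_le_real => z.
    by apply: cvgM (cp z); exact: cvg_cst.
  by rewrite exprMn exprVn sM mulrC ler_pdivrMr // mul1r.
have sq_re z : complex.Re (f z) ^+ 2 <= M.
  by apply: le_trans (fM z); rewrite /sqmod lerDl sqr_ge0.
have sq_im z : complex.Im (f z) ^+ 2 <= M.
  by apply: le_trans (fM z); rewrite /sqmod lerDr sqr_ge0.
have re_le := p_le _ (continuous_re cf) sq_re.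
have im_le := p_le _ (continuous_im cf) sq_im.
have zero_le : calculus_le 0 (fun=> 0).
  split=> [|y]; first exact: cst_continuous.
  have c1 : continuous (fun _ : circle R => 1 : R[i]^o).
    exact: cst_continuous.
  have := calculus_linear (-1) y c1 c1; rewrite scaleN1r addNr.
  rewrite (_ : (fun z => _) = fun=> 0); last first.
    by apply/funext => ?; rewrite mulr1 addNr.
  by move=> ->; rewrite sqn0 mul0r.
have := calculus_le_linear (s / 2)%:C re_le
          (calculus_le_linear ('i * (s / 2)%:C) im_le zero_le).
rewrite (_ : (fun z => _) = f); last first.
  apply/funext => z; rewrite addr0; case: (f z) => a b /=.
  by apply/eqP; rewrite eq_complex /=; apply/andP; split; apply/eqP; field;
    rewrite gt_eqF.
move=> [_ /(_ x)]; rewrite sqmodM !sqmod_real.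
rewrite (_ : sqmod 'i = 1); last by rewrite /sqmod /= expr0n expr1n add0r.
by congr (_ <= _ * _); rewrite -sM; field.
Qed.

End CalculusBound.

Section Projection.
Context {R : realType} {H K : hilbertType R} (J : {linear H -> K}).
Hypothesis isoJ : isometric_embedding J.

Lemma isometry_sqn h : sqn (J h) = sqn h.
Proof. by rewrite /sqn isoJ. Qed.

(** A minimising sequence for the distance from k to the range of J is Cauchy by
    the parallelogram identity. Its terms are almost orthogonal projections:
    moving J (u n) along J g cannot decrease the squared distance by more than
    harmonic n, hence |inner (k - J (u n)) (J g)| ^ 2 <= sqn g * harmonic n. *)
Lemma projection_exists (k : K) :
  exists h, forall h', inner (k - J h) (J h') = 0.
Proof.
have JZ (a : R[i]) h : J (a *: h) = a *: J h by exact: linearZ_LR.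
have JD g h : J (g + h) = J g + J h by exact: raddfD.
pose S := [set sqn (k - J h) | h in [set: H]].
have S0 : has_inf S.
  split; first by exists (sqn (k - J 0)), 0.
  by exists 0 => _ [h _ <-]; exact: sqn_ge0.
pose d := inf S.
have dle h : d <= sqn (k - J h) by apply: (ge_inf S0.2); exists h.
have /choice[u uP] : forall n : nat, exists h, sqn (k - J h) <= d + harmonic n.
  move=> n; have [_ [h _ <-] hd] := inf_adherent (harmonic_gt0 n) S0.
  by exists h; exact: ltW.
have [h uh] : exists h, sqn (u n - h) @[n --> \oo] --> (0 : R).
  apply: (@sqn_cauchy _ _ _ (fun n => 2 * harmonic n)).
    exact/nullZ/cvg_harmonic.
  move=> m n; have := parallelogram (k - J (u n)) (k - J (u m)).
  have -> : k - J (u n) - (k - J (u m)) = J (u m - u n).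
    by rewrite (raddfB J) opprB addrC subrKA.
  have -> : k - J (u n) + (k - J (u m)) =
      (2 : R)%:C *: (k - J ((2^-1 : R)%:C *: (u m + u n))).
    rewrite scalerBr JZ scalerA -rmorphM /= divff // scale1r.
    rewrite rmorph_nat scaler_nat mulr2n JD opprD addrACA.
    by rewrite [- J (u n) + _]addrC.
  rewrite isometry_sqn sqnZ sqmod_real.
  have := uP m; have := uP n; have := dle ((2^-1 : R)%:C *: (u m + u n)).
  by lra.
exists h => g; apply/sqmod_eq0/eqP; rewrite eq_le sqmod_ge0 andbT.
apply: null_ub (nullD (2 * sqn g) (2 * sqn g) cvg_harmonic uh) _ => n.
have -> : k - J h = (k - J (u n)) + J (u n - h).
  by rewrite (raddfB J) addrA subrK.
rewrite innerDl isoJ; apply: le_trans (sqmodD_le _ _) _.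
rewrite -!mulrA -mulrDr ler_pM2l //; apply: lerD; last first.
  by rewrite mulrC; exact: cauchy_schwarz.
set v := k - J (u n).
have [g0|g0] := eqVneq (sqn g) 0.
  by rewrite (sqn_eq0 g0) linear0 linear0r (sqmod_real 0) expr0n sqn0 mul0r.
have gpos : 0 < sqn g by rewrite lt_neqAle eq_sym g0 sqn_ge0.
have := sqn_residual v (J g); rewrite isometry_sqn.
pose c : R[i] := inner v (J g) / (sqn g)%:C.
have -> : (sqn g)%:C *: v - inner v (J g) *: J g =
    (sqn g)%:C *: (k - J (u n + c *: g)).
  rewrite JD JZ opprD addrA -/v [RHS]scalerBr scalerA /c mulrC divfK //.
  by rewrite -(rmorph0 (real_complex R)) (inj_eq (@complexI R)).
rewrite sqnZ sqmod_real expr2 -mulrA => /(mulfI g0) vE.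
have := ler_wpM2l (ltW gpos) (dle (u n + c *: g)).
rewrite vE => h1; have := ler_wpM2l (ltW gpos) (uP n); rewrite -/v /harmonic /=.
rewrite mulrDr -lerBlDl => h2; apply: le_trans h2.
by rewrite lerBrDr addrC -lerBrDr (mulrC (sqn g) (sqn _)); exact: h1.
Qed.

(** The weak form of the projection: matrix elements are read in K. *)
Lemma orthoprojP k h : inner (orthoproj J k) h = inner k (J h).
Proof.
have := xgetPex 0 (projection_exists k) h; rewrite -/(orthoproj J k).
by rewrite innerDl innerNl isoJ => /eqP; rewrite subr_eq0 => /eqP.
Qed.

End Projection.

(** * Independence of the dilation *)

Section DilationMatrixElements.
Context {R : realType} {H K1 K2 : hilbertType R} (T : 'B(H)).
Context (J1 : {linear H -> K1}) (U : 'B(K1)).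
Context (J2 : {linear H -> K2}) (V : 'B(K2)).
Hypotheses (dilU : unitary_dilation J1 T U) (dilV : unitary_dilation J2 T V).
Context (Phi : (circle R -> R[i]^o) -> 'B(K1)).
Context (Psi : (circle R -> R[i]^o) -> 'B(K2)).
Hypothesis PhiP : is_functional_calculus U Phi.
Hypothesis PsiP : is_functional_calculus V Psi.

(** Both sides are matrix elements of the n-th power of T. *)
Lemma dilation_opexpz n h h' :
  inner (opexpz U n (J1 h)) (J1 h') = inner (opexpz V n (J2 h)) (J2 h').
Proof.
have [iso1 _ TU] := dilU; have [iso2 _ TV] := dilV.
by rewrite -!orthoprojP // -TU -TV.
Qed.

(** Equality of matrix elements passes to linear combinations, and to uniform
    limits by calculus_bound. *)
Lemma dilation_calculus f h h' : continuous f ->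
  inner (Phi f (J1 h)) (J1 h') = inner (Psi f (J2 h)) (J2 h').
Proof.
pose P (g : circle R -> R[i]^o) := continuous g /\
  inner (Phi g (J1 h)) (J1 h') = inner (Psi g (J2 h)) (J2 h').
suff PT g : continuous g -> P g by move=> /PT[].
have [iso1 _ _] := dilU; have [iso2 _ _] := dilV.
apply: continuous_circle_ind => {f g}.
- move=> a f g [cf fE] [cg gE]; split; first exact: continuous_lin.
  rewrite (calculus_linear PhiP) // (calculus_linear PsiP) //.
  by rewrite !innerDl !innerZl fE gE.
- move=> k; split; first exact: continuous_coordX.
  rewrite (calculus_coordX PhiP) (calculus_coordX PsiP).
  exact: (dilation_opexpz (Posz k)).
- move=> k; split; first exact: continuous_coordJX.
  rewrite (calculus_coordJX PhiP) (calculus_coordJX PsiP).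
  case: k => [|k]; first exact: (dilation_opexpz (Posz 0)).
  exact: (dilation_opexpz (Negz k)).
move=> f cf approx; split=> //; apply/eqP; rewrite -subr_eq0.
apply/eqP/sqmod_eq0/eqP; rewrite eq_le sqmod_ge0 andbT.
apply: null_ub (nullZ (24 * (sqn h * sqn h')) cvg_harmonic) _ => n.
have [g [cg gE] fg] := approx _ (harmonic_gt0 n).
have cd := @continuous_lin _ (-1) g f cg cf.
have d_le z : sqmod (-1 * g z + f z) <= harmonic n.
  by rewrite mulN1r addrC fg.
have -> : inner (Phi f (J1 h)) (J1 h') - inner (Psi f (J2 h)) (J2 h') =
    inner (Phi (fun z => -1 * g z + f z) (J1 h)) (J1 h') -
    inner (Psi (fun z => -1 * g z + f z) (J2 h)) (J2 h').
  rewrite (calculus_linear PhiP) // (calculus_linear PsiP) //.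
  by rewrite !innerDl !innerZl gE opprD addrACA subrr add0r.
set d := fun z => _ in cd d_le *.
have := calculus_bound PhiP (J1 h) cd d_le (harmonic_gt0 n).
have := calculus_bound PsiP (J2 h) cd d_le (harmonic_gt0 n).
rewrite (isometry_sqn iso1 h) (isometry_sqn iso2 h).
move=> /(ler_wpM2r (sqn_ge0 h')) bPsi /(ler_wpM2r (sqn_ge0 h')) bPhi.
apply: le_trans (sqmodD_le _ _) _; rewrite sqmodN.
rewrite (_ : 24 * _ * _ = 2 * (6 * harmonic n * sqn h * sqn h' +
    6 * harmonic n * sqn h * sqn h')); last by rewrite /harmonic /=; ring.
rewrite ler_pM2l // lerD //; apply: le_trans (cauchy_schwarz _ _) _.
  by rewrite (isometry_sqn iso1 h').
by rewrite (isometry_sqn iso2 h').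
Qed.

End DilationMatrixElements.

Lemma cfcP (R : realType) (K : hilbertType R) (U : 'B(K)) :
  unitary_operator U -> is_functional_calculus U (cfc U).
Proof.
move=> uU; apply: (xgetPex (fun=> zero_operator K K)).
by exists (spectral_operator U); exact: functional_calculus_exists.
Qed.

Theorem mainTheorem5 (R : realType) (H K1 K2 : hilbertType R)
    (T : 'B(H)) (f : circle R -> R[i]^o)
    (J1 : {linear H -> K1}) (U : 'B(K1)) (J2 : {linear H -> K2}) (V : 'B(K2)) :
  contraction_operator T ->
  continuous f ->
  unitary_dilation J1 T U ->
  unitary_dilation J2 T V ->
  compression J1 (cfc U f) = compression J2 (cfc V f).
Proof.
move=> _ cf dilU dilV; have [iso1 uU _] := dilU; have [iso2 uV _] := dilV.
apply/funext => h; apply/eqP; rewrite -subr_eq0; apply/eqP/sqn_eq0.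
set d := _ - _; rewrite /sqn; suff -> : inner d d = 0 by [].
rewrite {1}/d innerDl innerNl /compression !orthoprojP //.
rewrite (dilation_calculus dilU dilV (cfcP uU) (cfcP uV)) //.
exact: subrr.
Qed.
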